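(* Let $m,n$ be positive integers and let $E=(\varepsilon_{ij})$ be an $n$-by-$m$ complex matrix such that: (i) the entries of the first column of $E$ form the spectrum of a nonnegative circulant matrix $S_0$; (ii) the multiset $\{E\}$ formed by the entries of $E$ is closed under complex conjugation; (iii) $\varepsilon_{11}$ is positive and has the largest absolute value among the absolute values of the entries of $E$; (iv) for $\ell=1,\ldots,\lfloor m/2\rfloor$, $Eq_{\ell+1}=\overline{Eq_{m-\ell+1}}$, where $q_1,\ldots,q_m$ are the canonical (column) vectors of $\mathbb{R}^m$ (that is, the $(m-\ell+1)$-th column of $E$ is the entrywise complex conjugate of the $(\ell+1)$-th column). Put $\omega=\cos\frac{2\pi}{m}+i\sin\frac{2\pi}{m}$, $\tau=\cos\frac{2\pi}{n}+i\sin\frac{2\pi}{n}$, and for $j=0,\ldots,n-1$, $k=0,\ldots,m-1$, $$\Phi_{j,k}=\sum_{p=1}^{n-1}\varepsilon_{(p+1)1}\tau^{-jp}+\sum_{\ell=1}^{m-1}\omega^{-k\ell}\varepsilon_{1(\ell+1)}+\sum_{\ell=1}^{m-1}\sum_{p=1}^{n-1}\varepsilon_{(p+1)(\ell+1)}\,\omega^{-k\ell}\tau^{-jp}.$$ If $$\varepsilon_{11}\ \ge\ \max_{0\le j\le n-1,\ 0\le k\le m-1}\bigl(-\Phi_{j,k}\bigr)$$ (this inequality being understood to mean that every $\Phi_{j,k}$ is real and $\varepsilon_{11}\ge-\Phi_{j,k}$ for all $j,k$), then $\{E\}$ is the spectrum (counting multiplicities) of a nonnegative block circulant $mn$-by-$mn$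 matrix $A$, partitioned into $n^2$ blocks each of which is an $m$-by-$m$ circulant matrix.
   Context: A circulant matrix $circ(a_0,\ldots,a_{r-1})$ is the $r$-by-$r$ matrix with first row $(a_0,\ldots,a_{r-1})$ in which each row is the cyclic shift to the right by one position of the row above. A block circulant matrix is a block matrix with first block row $(A_0,A_1,\ldots,A_{r-1})$ in which each block row is the cyclic shift to the right by one block of the block row above: its block rows are $(A_0,A_1,\ldots,A_{r-1})$, $(A_{r-1},A_0,\ldots,A_{r-2})$, ..., $(A_1,A_2,\ldots,A_0)$. A matrix is nonnegative if all its entries are real and $\geq 0$. *)

(* Defs.v *)
(* The field of complex numbers is R[i], for any R : realType. *)
From mathcomp Require Export all_boot all_order all_algebra.
From mathcomp Require Export reals trigo.
From mathcomp Require Export complex mxtens.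

Set Implicit Arguments.
Unset Strict Implicit.
Unset Printing Implicit Defensive.

Import Order.TTheory GRing.Theory Num.Theory.
Local Open Scope ring_scope.

(* Every row but the first is the row above shifted cyclically to the right by
   one position; ordS j is the column j + 1 modulo r. The entries may lie in any
   type, so that this also applies to a matrix of blocks. *)
Definition circulant (T : Type) (r : nat) (A : 'M[T]_r) : Prop :=
  forall i i' : 'I_r, i' = i.+1 :> nat -> forall j, A i' (ordS j) = A i j.

(* mxtens_index (p, a) has value p * m + a, so blocks p q A collects the rows
   p * m, ..., p * m + m - 1 and the columns q * m, ..., q * m + m - 1. *)
Definition blocks (T : Type) (n m : nat) (A : 'M[T]_(n * m)) : 'M['M[T]_m]_n :=
  \matrix_(p < n, q < n)
    \matrix_(a < m, b < m) A (mxtens_index (p, a)) (mxtens_index (q, b)).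

Definition block_circulant (T : Type) (n m : nat) (A : 'M[T]_(n * m)) : Prop :=
  circulant (blocks A).

(* In R[i], 0 <= z means that z is real and nonnegative. *)
Definition nonnegative_mx (R : realType) (r s : nat) (A : 'M[R[i]]_(r, s)) :
  Prop := forall i j, 0 <= A i j.

(* The eigenvalues of A, with algebraic multiplicities, are the terms of s. *)
Definition has_spectrum (R : realType) (r : nat) (A : 'M[R[i]]_r)
    (s : seq R[i]) : Prop :=
  char_poly A = \prod_(z <- s) ('X - z%:P).

(* Considered up to perm_eq, this is the multiset of the entries of E. *)
Definition entries (T : Type) (r s : nat) (E : 'M[T]_(r, s)) : seq T :=
  [seq E ij.1 ij.2 | ij : 'I_r * 'I_s].

Definition unit_root (R : realType) (r : nat) : R[i] :=
  Complex (cos (2 * pi / r%:R)) (sin (2 * pi / r%:R)).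

Section Phi.
Variables (R : realType) (m n : nat) (hm : (0 < m)%N) (hn : (0 < n)%N).
Variable E : 'M[R[i]]_(n, m).

Let omega : R[i] := unit_root R m.
Let tau : R[i] := unit_root R n.

Definition Phi (j : 'I_n) (k : 'I_m) : R[i] :=
  \sum_(p < n | (0 < p)%N) E p (Ordinal hm) * tau ^- (j * p)
  + \sum_(l < m | (0 < l)%N) omega ^- (k * l) * E (Ordinal hn) l
  + \sum_(l < m | (0 < l)%N) \sum_(p < n | (0 < p)%N)
      E p l * omega ^- (k * l) * tau ^- (j * p).

End Phi.

(* Main.v *)
(* The tensor product F of the Fourier matrices of orders n and m diagonalizes
   every block circulant matrix with circulant blocks. So A = F D F^-1, where D
   is the diagonal matrix of the entries of E, has the required shape and
   spectrum, and each entry of A is (E_11 + Phi_{j,k}) / (n m) for some j, k. *)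
Require Import Defs.
From mathcomp Require Import ring lra.

Import Order.TTheory GRing.Theory Num.Theory.
Local Open Scope ring_scope.

Lemma de_Moivre (R : realType) (x : R) (k : nat) :
  Complex (cos x) (sin x) ^+ k = Complex (cos (x *+ k)) (sin (x *+ k)).
Proof.
elim: k => [|k IHk]; first by rewrite expr0 !mulr0n cos0 sin0.
rewrite exprS IHk !mulrS cosD sinD; apply/eqP.
by rewrite eq_complex /= [sin x * _ + _]addrC !eqxx.
Qed.

(** By [de_Moivre] the power [i.+1] has angle [2 * x] with [x = pi * (i.+1 / r)] in [(0, pi]]. At
    [x = pi] the power is 1. Below [pi], [sin x > 0] forces
    [cos (2 * x) = 1 - 2 * sin x ^ 2 < 1]. *)
Lemma unit_root_prim (R : realType) (r : nat) :
  (0 < r)%N -> r.-primitive_root (unit_root R r).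
Proof.
move=> r_gt0; have rR : (0 : R) < r%:R by rewrite ltr0n.
apply/andP; split=> //; apply/forallP => i; rewrite unity_rootE de_Moivre.
have -> : 2 * pi / r%:R *+ i.+1 = (pi * (i.+1%:R / r%:R)) *+ 2 :> R.
  by rewrite -mulr_natr -[in RHS]mulr_natl !mulrA mulrAC.
set x := pi * _; apply/eqP; have := ltn_ord i.
rewrite leq_eqVlt => /predU1P[Di | ltir].
  have -> : x = pi by rewrite /x Di divff ?mulr1 // gt_eqF.
  by rewrite Di eqxx cos2pi sin2pi eqxx.
rewrite (ltn_eqF ltir); apply/negbTE/negP.
have sin_gt0 : 0 < sin x.
  apply: sin_gt0_pi; rewrite mulr_gt0 ?pi_gt0 ?divr_gt0 ?ltr0n //=.
  by rewrite gtr_pMr ?pi_gt0 // ltr_pdivrMr // mul1r ltr_nat.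
rewrite eq_complex /= => /andP[/eqP cosE _].
have: sin x ^+ 2 = 0.
  have := cos_mulr2n x; rewrite cosE cos2sin2; lra.
by move/eqP; rewrite expf_eq0 /= gt_eqF.
Qed.

Definition fourier_mx {F : fieldType} (n : nat) (z : F) : 'M[F]_n := \matrix_(i, j) z ^+ (i * j).

Lemma sum_expr_root (F : fieldType) (n : nat) (z : F) :
  z ^+ n = 1 -> z != 1 -> \sum_(i < n) z ^+ i = 0.
Proof.
move=> zn1; rewrite -subr_eq0 => /mulfI; apply.
by rewrite -subrX1 zn1 subrr mulr0.
Qed.

(** Orthogonality of characters: entry [(i, j)] is the sum of the first [n] powers of
    [z ^+ i / z ^+ j], an [n]-th root of unity that equals 1 only when [i = j]. *)
Lemma mul_fourier_mxV (F : fieldType) (n : nat) (z : F) :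
  n.-primitive_root z -> fourier_mx n z *m fourier_mx n z^-1 = n%:R%:M.
Proof.
move=> prim_z; apply/matrixP => i j; rewrite !mxE.
have z0 : z != 0 by rewrite (prim_root_eq0 prim_z) -lt0n (prim_order_gt0 prim_z).
under eq_bigr => k _ do
  rewrite !mxE [(k * j)%N]mulnC !exprM -exprMn exprVn.
have [<- | neq_ij] := eqVneq.
  under eq_bigr => k _ do rewrite divff ?expf_neq0 // expr1n.
  by rewrite sumr_const card_ord.
apply: sum_expr_root.
  rewrite exprMn exprVn -!exprM ![(_ * n)%N]mulnC !exprM.
  by rewrite (prim_expr_order prim_z) !expr1n invr1 mulr1.
apply: contra neq_ij => /eqP/(canRL (mulfVK _)); rewrite expf_neq0 // mul1r.
by move=> /(_ isT)/eqP; rewrite (eq_prim_root_expr prim_z) !modn_small.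
Qed.

(** Reduces [k - i] modulo [n] to an index [j] below [n], the form in which the exponents occur in
    [Phi]. *)
Lemma div_prim_root (F : fieldType) (n : nat) (z : F) (i k : nat) :
  n.-primitive_root z -> exists j : 'I_n, z ^+ i / z ^+ k = z ^- j.
Proof.
move=> prim_z; have zk1 l : (z ^+ l) ^+ n = 1.
  by rewrite -exprM mulnC exprM (prim_expr_order prim_z) expr1n.
(* The inverse quotient is used because [j] must appear with a negative exponent. *)
have [|j Dj] := prim_rootP (x := z ^+ k / z ^+ i) prim_z.
  by rewrite exprMn exprVn !zk1 invr1 mulr1.
by exists j; rewrite -Dj invf_div.
Qed.

(** Source of both circulant properties: a quotient of powers is unchanged by a simultaneous shift,
    and the wrap-around of [ordS] is harmless since [z ^+ n = 1]. *)
Lemma prim_root_divS (F : fieldType) (n : nat) (z : F) (i k : 'I_n) :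
  n.-primitive_root z -> z ^+ i.+1 / z ^+ ordS k = z ^+ i / z ^+ k.
Proof.
move=> prim_z; rewrite /= (prim_expr_mod prim_z) !exprS -mulf_div divff ?mul1r //.
by rewrite (prim_root_eq0 prim_z) -lt0n (prim_order_gt0 prim_z).
Qed.

Lemma char_poly_conj (R : comNzRingType) (n : nat) (P Q D : 'M[R]_n) :
  P *m Q = 1%:M -> char_poly (P *m D *m Q) = char_poly D.
Proof.
move=> PQ1; pose toP := map_mx (@polyC R).
have PQ1p : toP _ _ P *m toP _ _ Q = 1%:M by rewrite -map_mxM PQ1 map_mx1.
rewrite /char_poly /char_poly_mx !map_mxM /=.
(* Scalar matrices are central, so the characteristic matrix becomes [P *m ('X%:M - D) *m Q] over
   the polynomials; then [det P * det Q = 1]. *)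
rewrite [in LHS](_ : 'X%:M = toP _ _ P *m 'X%:M *m toP _ _ Q); last first.
  by rewrite scalar_mxC -mulmxA PQ1p mulmx1.
rewrite -mulmxBl -mulmxBr !det_mulmx mulrAC -det_mulmx PQ1p det1 mul1r.
by reflexivity.
Qed.

Lemma has_spectrum_diag (R : realType) (r : nat) (d : 'rV[R[i]]_r) :
  has_spectrum (diag_mx d) [seq d 0 k | k : 'I_r].
Proof.
rewrite /has_spectrum char_poly_trig ?diag_mx_is_trig // big_image /=.
by apply: eq_bigr => k _; rewrite mxE eqxx.
Qed.

Lemma perm_entries_mxtens (T : eqType) (n m : nat) (E : 'M[T]_(n, m)) :
  perm_eq [seq E (mxtens_unindex k).1 (mxtens_unindex k).2 | k : 'I_(n * m)]
          (entries E).
Proof.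
rewrite /entries /image_mem.
rewrite (map_comp (fun ij => E ij.1 ij.2) (@mxtens_unindex n m)).
apply: perm_map; apply: uniq_perm; rewrite ?enum_uniq //.
  by rewrite map_inj_uniq ?enum_uniq //; exact: can_inj (@mxtens_unindexK n m).
move=> ij; rewrite mem_enum inE; apply/mapP.
by exists (mxtens_index ij); rewrite ?mem_enum ?mxtens_indexK.
Qed.

Lemma blocksE (T : Type) (n m : nat) (A : 'M[T]_(n * m)) (p q : 'I_n)
    (a b : 'I_m) :
  blocks A p q a b = A (mxtens_index (p, a)) (mxtens_index (q, b)).
Proof. by rewrite mxE mxE. Qed.

(** The factor of order [n] comes first, so that it acts on block indices and the factor of order
    [m] acts inside blocks, as in [blocks]. The scalar makes the last factor the inverse of the
    first. *)
Definition spectral_mx {R : realType} {n m : nat} (E : 'M[R[i]]_(n, m)) :=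
  let tau := unit_root R n in let omega := unit_root R m in
  (fourier_mx n tau *t fourier_mx m omega)
  *m diag_mx (\row_k E (mxtens_unindex k).1 (mxtens_unindex k).2)
  *m ((n * m)%:R^-1 *: (fourier_mx n tau^-1 *t fourier_mx m omega^-1)).

Section SpectralMatrix.
Variables (R : realType) (n m : nat) (n_gt0 : (0 < n)%N) (m_gt0 : (0 < m)%N).
Variable E : 'M[R[i]]_(n, m).
Let tau := unit_root R n.
Let omega := unit_root R m.

(** The indices enter only through [tau ^+ p / tau ^+ q] and [omega ^+ a / omega ^+ b], which
    exposes the two-level circulant structure. *)
Lemma spectral_mxE (p q : 'I_n) (a b : 'I_m) :
  spectral_mx E (mxtens_index (p, a)) (mxtens_index (q, b))
  = (n * m)%:R^-1 * \sum_(s < m) \sum_(r < n)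
      E r s * (omega ^+ a / omega ^+ b) ^+ s * (tau ^+ p / tau ^+ q) ^+ r.
Proof.
rewrite /spectral_mx mul_mx_diag -scalemxAr !mxE; congr (_ * _).
rewrite exchange_big pair_big (reindex (@mxtens_index n m)); last first.
  by exists (@mxtens_unindex n m) => k _; rewrite (mxtens_indexK, mxtens_unindexK).
apply: eq_bigr => -[r s] _; rewrite !mxE !mxtens_indexK /=.
rewrite -/tau -/omega !exprMn -!exprVn -!exprM [(s * b)%N]mulnC [(r * q)%N]mulnC.
by ring.
Qed.

Lemma spectral_mx_spectrum : has_spectrum (spectral_mx E) (entries E).
Proof.
rewrite /has_spectrum /spectral_mx char_poly_conj; last first.
  rewrite -scalemxAr tensmx_mul !mul_fourier_mxV ?unit_root_prim //.
  apply/matrixP => i j.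
  case: (mxtens_indexP i) => p a; case: (mxtens_indexP j) => q b.
  rewrite mxE tensmxE !mxE.
  rewrite (can_eq (@mxtens_indexK n m)) xpair_eqE natrM.
  have nm0 : n%:R * m%:R != 0 :> R[i].
    by rewrite mulf_neq0 // pnatr_eq0 -lt0n.
  case: (p == q) (a == b) => [] []; rewrite ?mulr0n ?mulr1n ?mul0r ?mulr0 //.
  by rewrite mulVf.
rewrite has_spectrum_diag; apply: perm_big.
(* The diagonal lists the entries of [E] in tensor order, a reordering of [entries E]. *)
rewrite /image_mem; under [X in perm_eq X]eq_map => k do rewrite mxE.
exact: perm_entries_mxtens.
Qed.

Lemma spectral_mx_block_circulant : block_circulant (spectral_mx E).
Proof.
move=> p p' Dp q; apply/matrixP => a b; rewrite !blocksE !spectral_mxE Dp.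
by rewrite (prim_root_divS _ _ _ p q (unit_root_prim R n n_gt0)).
Qed.

Lemma spectral_mx_circulant_blocks (p q : 'I_n) :
  circulant (blocks (spectral_mx E) p q).
Proof.
move=> a a' Da b; rewrite !blocksE !spectral_mxE Da.
by rewrite (prim_root_divS _ _ _ a b (unit_root_prim R m m_gt0)).
Qed.

(** The three sums of [Phi] are the first column, the first row and the rest of one double Fourier
    sum, whose missing corner term has both exponents zero and hence equals [E] at the corner. *)
Lemma PhiE (j : 'I_n) (k : 'I_m) :
  E (Ordinal n_gt0) (Ordinal m_gt0) + Phi m_gt0 n_gt0 E j k
  = \sum_(s < m) \sum_(r < n) E r s * omega ^- (k * s) * tau ^- (j * r).
Proof.
have gt0E l (l_gt0 : (0 < l)%N) (i : 'I_l) : (i != Ordinal l_gt0) = (0 < i)%N.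
  by rewrite lt0n.
rewrite (bigD1 (Ordinal m_gt0)) //= (eq_bigl _ _ (gt0E m m_gt0)).
under [X in _ = _ + X]eq_bigr => s _.
  rewrite (bigD1 (Ordinal n_gt0)) //= (eq_bigl _ _ (gt0E n n_gt0)).
  rewrite muln0 expr0 invr1 mulr1 [E _ s * _]mulrC.
  over.
rewrite big_split /= (bigD1 (Ordinal n_gt0)) //= (eq_bigl _ _ (gt0E n n_gt0)).
rewrite !muln0 !expr0 !invr1 !mulr1 /Phi !addrA.
by under [X in _ = _ + X + _ + _]eq_bigr => r _ do rewrite mulr1.
Qed.

Lemma spectral_mx_ge0 :
  (forall (j : 'I_n) (k : 'I_m),
     - Phi m_gt0 n_gt0 E j k <= E (Ordinal n_gt0) (Ordinal m_gt0)) ->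
  nonnegative_mx (spectral_mx E).
Proof.
move=> Phi_ge i i'.
case: (mxtens_indexP i) => p a; case: (mxtens_indexP i') => q b.
(* Here [j] is [q - p] modulo [n], and below [k] is [b - a] modulo [m]: these select the [Phi j k]
   that governs this entry. *)
have [j Dj] := div_prim_root _ _ _ p q (unit_root_prim R n n_gt0).
have [k Dk] := div_prim_root _ _ _ a b (unit_root_prim R m m_gt0).
rewrite spectral_mxE Dj Dk mulr_ge0 ?invr_ge0 ?ler0n //.
under eq_bigr => s _ do under eq_bigr => r _ do rewrite !exprVn -!exprM.
by rewrite -PhiE -lerBlDr sub0r.
Qed.

End SpectralMatrix.

Theorem theorem25 (R : realType) (m n : nat) (hm : (0 < m)%N) (hn : (0 < n)%N)
    (E : 'M[R[i]]_(n, m))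
    (h_col1 : exists S0 : 'M[R[i]]_n,
      [/\ nonnegative_mx S0, circulant S0
        & has_spectrum S0 (entries (col (Ordinal hm) E))])
    (h_conj : perm_eq [seq Num.conj z | z <- entries E] (entries E))
    (h_pos : 0 < E (Ordinal hn) (Ordinal hm))
    (h_max : forall i j, `|E i j| <= `|E (Ordinal hn) (Ordinal hm)|)
    (h_cols : forall l l' : 'I_m, (1 <= l <= m %/ 2)%N -> l' = (m - l)%N :> nat ->
      E *m delta_mx l 0 = map_mx Num.conj (E *m delta_mx l' 0) :> 'cV[R[i]]_n)
    (h_Phi : forall (j : 'I_n) (k : 'I_m),
      Phi hm hn E j k \is Num.real /\
      - Phi hm hn E j k <= E (Ordinal hn) (Ordinal hm)) :
  exists A : 'M[R[i]]_(n * m),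
    [/\ nonnegative_mx A,
        block_circulant A,
        forall p q : 'I_n, circulant (blocks A p q)
      & has_spectrum A (entries E)].
Proof.
exists (spectral_mx E); split.
- by apply: spectral_mx_ge0 => j k; case: (h_Phi j k).
- exact: spectral_mx_block_circulant.
- exact: spectral_mx_circulant_blocks.
- exact: spectral_mx_spectrum.
Qed.
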